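(* Let $\lambda>0$ and consider radial real-valued solutions $u\in C^\infty(\overline{\mathbb D})$ of $$-\Delta u=e^{2u}\ \text{ in }\mathbb D,\qquad \frac{\partial u}{\partial \nu}+\lambda=e^{u}\ \text{ on }\mathbb S^1. \qquad (P_\lambda)$$ For $R>0$ put $$u_R(z)=\log\frac{2R}{1+R^2|z|^2}.$$ (i) If $0<\lambda<2$, then $(P_\lambda)$ admits a unique radial solution, and it is of the form $u_R$ with $$R=\frac{\lambda}{1+\sqrt{1+2\lambda-\lambda^2}}.$$ (ii) If $\lambda=2$, then $(P_\lambda)$ admits a unique radial solution, and it is of the form $u_R$ with $R=1$. (iii) If $2<\lambda<1+\sqrt2$, then $(P_\lambda)$ admits exactly two radial solutions, and they are of the form $u_R$ with $R=R_+$ and $R=R_-$, where $$R_\pm=\frac{1\pm\sqrt{1+2\lambda-\lambda^2}}{\lambda-2}.$$ (iv) If $\lambda=1+\sqrt2$, then $(P_\lambda)$ admits a unique radial solution, and it is of the form $u_R$ with $R=1+\sqrt2$. (v) If $\lambda>1+\sqrt2$, then $(P_\lambda)$ has no radial solution.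
   Context: $\mathbb D=\{z\in\mathbb C:|z|<1\}$ is the open unit disk, $\mathbb S^1=\partial\mathbb D$, $\nu$ is the outer unit normal on $\mathbb S^1$, and $\Delta$ is the Euclidean Laplacian. $C^\infty(\overline{\mathbb D})$ denotes functions smooth up to the boundary. Radial means $u(e^{i\alpha}z)=u(z)$ for all $\alpha\in\mathbb R$. *)

(* Defs.v *)
From Stdlib Require Import Reals.
From Coquelicot Require Import Coquelicot.
Local Open Scope R_scope.

Definition open_disk (z : C) : Prop := Cmod z < 1.
Definition closed_disk (z : C) : Prop := Cmod z <= 1.
Definition unit_circle (z : C) : Prop := Cmod z = 1.

(* Functions on the closed disk are represented by total functions on [C];
   every notion below depends only on their values on [closed_disk], and this
   is the equality under which solutions are compared. *)
Definition eq_on_closed_disk (u v : C -> R) : Prop :=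
  forall z : C, closed_disk z -> u z = v z.

Definition in_coords (u : C -> R) (x y : R) : R := u (x, y).

(* [u] is continuous on the closed disk, is C^n for every n in the open disk,
   and each of its partial derivatives there extends continuously to the
   closed disk.  The order of differentiation is immaterial, since the mixed
   partial derivatives of a smooth function commute. *)
Definition smooth_up_to_boundary (u : C -> R) : Prop :=
  continuous_on closed_disk u /\
  (forall (n : nat) (z : C), open_disk z ->
     ex_diff_n (in_coords u) n (Re z) (Im z)) /\
  (forall m k : nat, exists g : C -> R,
     continuous_on closed_disk g /\
     forall z : C, open_disk z ->
       g z = partial_derive m k (in_coords u) (Re z) (Im z)).

Definition laplacian (u : C -> R) (z : C) : R :=
  partial_derive 2 0 (in_coords u) (Re z) (Im z) +
  partial_derive 0 2 (in_coords u) (Re z) (Im z).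

Definition outer_normal (zeta : C) : C := zeta.

(* The directional derivative along the outer normal is one-sided: for [h]
   slightly below 0 the point [zeta + h * outer_normal zeta] is in the disk. *)
Definition is_normal_derive (u : C -> R) (zeta : C) (l : R) : Prop :=
  filterlim
    (fun h : R => (u (Cplus zeta (Cmult (RtoC h) (outer_normal zeta))) - u zeta) / h)
    (at_left 0) (locally l).

(* e^{i alpha} *)
Definition cis (alpha : R) : C := (cos alpha, sin alpha).

Definition radial (u : C -> R) : Prop :=
  forall (alpha : R) (z : C), closed_disk z -> u (Cmult (cis alpha) z) = u z.

Definition solves_P (lambda : R) (u : C -> R) : Prop :=
  (forall z : C, open_disk z -> - laplacian u z = exp (2 * u z)) /\
  (forall zeta : C, unit_circle zeta ->
     exists d : R, is_normal_derive u zeta d /\ d + lambda = exp (u zeta)).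

Definition radial_solution (lambda : R) (u : C -> R) : Prop :=
  smooth_up_to_boundary u /\ radial u /\ solves_P lambda u.

Definition unique_radial_solution (lambda : R) (u : C -> R) : Prop :=
  radial_solution lambda u /\
  forall v : C -> R, radial_solution lambda v -> eq_on_closed_disk v u.

Definition exactly_two_radial_solutions (lambda : R) (u1 u2 : C -> R) : Prop :=
  radial_solution lambda u1 /\ radial_solution lambda u2 /\
  ~ eq_on_closed_disk u1 u2 /\
  forall v : C -> R, radial_solution lambda v ->
    eq_on_closed_disk v u1 \/ eq_on_closed_disk v u2.

(* u_R, meaningful for [rho] = R > 0. *)
Definition u_ (rho : R) (z : C) : R :=
  ln (2 * rho / (1 + rho ^ 2 * Cmod z ^ 2)).

(* Main.v *)
Require Import Defs.
From Stdlib Require Import Reals Lra Psatz.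
From Coquelicot Require Import Coquelicot.
Local Open Scope R_scope.

(* For a radial solution put f(r) = u(r), so -(f'' + f'/r) = e^{2f} on (0,1).  The
   quantity (1 + r f')^2 + r^2 e^{2f} is conserved and equals 1 at the centre, which
   makes (e^{-f})'/r constant.  Hence e^{-f} is affine in r^2, and the conserved
   quantity then leaves only f = u_R with R = e^{f(0)}/2, without any uniqueness
   theorem for singular ODEs.  On u_R the boundary condition reads
   (lambda - 2) R^2 - 2 R + lambda = 0, whose positive roots give the five cases. *)

(** * Partial derivatives and smoothness of $u_R$ *)

Lemma bubble_den_pos (rho x y : R) : 0 < 1 + rho ^ 2 * (x ^ 2 + y ^ 2).
Proof.
pose proof (pow2_ge_0 (rho * x)) as Hx; pose proof (pow2_ge_0 (rho * y)) as Hy.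
replace (rho ^ 2 * (x ^ 2 + y ^ 2)) with ((rho * x) ^ 2 + (rho * y) ^ 2) by ring.
lra.
Qed.

(* [x], [y], [InvDen] = 1/(1 + rho^2 |z|^2) and [Bubble] = u_rho generate an algebra
   closed under both partial derivatives; this gives the partial derivatives of
   u_rho of every order at once. *)
Inductive expr : Type :=
| Const (c : R)
| VarX
| VarY
| InvDen
| Bubble
| Add (e1 e2 : expr)
| Mul (e1 e2 : expr).

Fixpoint eval (rho : R) (e : expr) (x y : R) : R :=
  match e with
  | Const c => c
  | VarX => x
  | VarY => y
  | InvDen => / (1 + rho ^ 2 * (x ^ 2 + y ^ 2))
  | Bubble => ln (2 * rho / (1 + rho ^ 2 * (x ^ 2 + y ^ 2)))
  | Add e1 e2 => eval rho e1 x y + eval rho e2 x y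
  | Mul e1 e2 => eval rho e1 x y * eval rho e2 x y
  end.

Fixpoint dx (rho : R) (e : expr) : expr :=
  match e with
  | Const _ | VarY => Const 0
  | VarX => Const 1
  | InvDen => Mul (Const (- 2 * rho ^ 2)) (Mul VarX (Mul InvDen InvDen))
  | Bubble => Mul (Const (- 2 * rho ^ 2)) (Mul VarX InvDen)
  | Add e1 e2 => Add (dx rho e1) (dx rho e2)
  | Mul e1 e2 => Add (Mul (dx rho e1) e2) (Mul e1 (dx rho e2))
  end.

Fixpoint dy (rho : R) (e : expr) : expr :=
  match e with
  | Const _ | VarX => Const 0
  | VarY => Const 1
  | InvDen => Mul (Const (- 2 * rho ^ 2)) (Mul VarY (Mul InvDen InvDen))
  | Bubble => Mul (Const (- 2 * rho ^ 2)) (Mul VarY InvDen)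
  | Add e1 e2 => Add (dy rho e1) (dy rho e2)
  | Mul e1 e2 => Add (Mul (dy rho e1) e2) (Mul e1 (dy rho e2))
  end.

Lemma is_derive_eval_x (rho : R) (e : expr) (x y : R) : 0 < rho ->
  is_derive (fun t : R => eval rho e t y) x (eval rho (dx rho e) x y).
Proof.
intros Hrho; pose proof (bubble_den_pos rho x y) as Hden.
induction e as [c| | | | |e1 IH1 e2 IH2|e1 IH1 e2 IH2]; simpl eval.
- apply @is_derive_const.
- apply @is_derive_id.
- apply @is_derive_const.
- auto_derive; [lra|]. field; lra.
- auto_derive; [|field; lra].
  split; [lra|]. split; [|exact I].
  apply Rdiv_lt_0_compat; lra.
- now apply @is_derive_plus.
- apply (is_derive_mult (fun t => eval rho e1 t y) (fun t => eval rho e2 t y));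
    auto using Rmult_comm.
Qed.

Lemma is_derive_eval_y (rho : R) (e : expr) (x y : R) : 0 < rho ->
  is_derive (fun t : R => eval rho e x t) y (eval rho (dy rho e) x y).
Proof.
intros Hrho; pose proof (bubble_den_pos rho x y) as Hden.
induction e as [c| | | | |e1 IH1 e2 IH2|e1 IH1 e2 IH2]; simpl eval.
- apply @is_derive_const.
- apply @is_derive_const.
- apply @is_derive_id.
- auto_derive; [lra|]. field; lra.
- auto_derive; [|field; lra].
  split; [lra|]. split; [|exact I].
  apply Rdiv_lt_0_compat; lra.
- now apply @is_derive_plus.
- apply (is_derive_mult (fun t => eval rho e1 x t) (fun t => eval rho e2 x t));
    auto using Rmult_comm.
Qed.

Lemma continuity_2d_pt_eval (rho : R) (e : expr) (x y : R) : 0 < rho ->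
  continuity_2d_pt (eval rho e) x y.
Proof.
intros Hrho; pose proof (bubble_den_pos rho x y) as Hden.
assert (Hcont : continuity_2d_pt (fun u v => 1 + rho ^ 2 * (u ^ 2 + v ^ 2)) x y).
{ apply continuity_2d_pt_plus; [apply continuity_2d_pt_const|].
  apply continuity_2d_pt_mult; [apply continuity_2d_pt_const|].
  apply continuity_2d_pt_plus; simpl;
    repeat apply continuity_2d_pt_mult;
    auto using continuity_2d_pt_id1, continuity_2d_pt_id2, continuity_2d_pt_const. }
assert (Hinv := continuity_2d_pt_inv _ _ _ Hcont (Rgt_not_eq _ _ Hden)).
induction e as [c| | | | |e1 IH1 e2 IH2|e1 IH1 e2 IH2]; simpl eval.
- apply continuity_2d_pt_const.
- apply continuity_2d_pt_id1.
- apply continuity_2d_pt_id2.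
- exact Hinv.
- apply (continuity_1d_2d_pt_comp ln
    (fun u v => 2 * rho / (1 + rho ^ 2 * (u ^ 2 + v ^ 2)))).
  + apply derivable_continuous_pt; eexists.
    apply derivable_pt_lim_ln, Rdiv_lt_0_compat; lra.
  + now apply continuity_2d_pt_mult; [apply continuity_2d_pt_const|].
- now apply continuity_2d_pt_plus.
- now apply continuity_2d_pt_mult.
Qed.

Lemma ex_diff_n_eval (rho : R) (n : nat) (e : expr) (x y : R) : 0 < rho ->
  ex_diff_n (eval rho e) n x y.
Proof.
(* The induction is over all expressions at once: it is applied to [dx rho e] and [dy rho e], not to
   [e]. *)
intros Hrho; revert e x y.
induction n as [|n IH]; intros e x y; (split; [now apply continuity_2d_pt_eval|]).
  exact I.
split; [eexists; now apply is_derive_eval_x|].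
split; [eexists; now apply is_derive_eval_y|].
split.
- apply ex_diff_n_ext_loc with (2 := IH (dx rho e) x y).
  apply locally_2d_forall; intros u v; symmetry.
  now apply is_derive_unique, is_derive_eval_x.
- apply ex_diff_n_ext_loc with (2 := IH (dy rho e) x y).
  apply locally_2d_forall; intros u v; symmetry.
  now apply is_derive_unique, is_derive_eval_y.
Qed.

Lemma Derive_n_eval_x (rho : R) (e : expr) (n : nat) (x y : R) : 0 < rho ->
  Derive_n (fun t : R => eval rho e t y) n x = eval rho (Nat.iter n (dx rho) e) x y.
Proof.
intros Hrho; revert x; induction n as [|n IH]; intros x; [reflexivity|].
simpl. rewrite (Derive_ext _ _ _ IH).
now apply is_derive_unique, is_derive_eval_x.
Qed.

Lemma Derive_n_eval_y (rho : R) (e : expr) (n : nat) (x y : R) : 0 < rho ->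
  Derive_n (fun t : R => eval rho e x t) n y = eval rho (Nat.iter n (dy rho) e) x y.
Proof.
intros Hrho; revert y; induction n as [|n IH]; intros y; [reflexivity|].
simpl. rewrite (Derive_ext _ _ _ IH).
now apply is_derive_unique, is_derive_eval_y.
Qed.

Lemma partial_derive_eval (rho : R) (e : expr) (m k : nat) (x y : R) : 0 < rho ->
  partial_derive m k (eval rho e) x y =
  eval rho (Nat.iter m (dx rho) (Nat.iter k (dy rho) e)) x y.
Proof.
intros Hrho; unfold partial_derive; rewrite <- Derive_n_eval_x by assumption.
apply Derive_n_ext; intros t; now apply Derive_n_eval_y.
Qed.

Lemma u_eval (rho : R) (z : C) : u_ rho z = eval rho Bubble (Re z) (Im z).
Proof. unfold u_; simpl eval; now rewrite Cmod2_alt. Qed.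

Lemma continuous_on_eval (rho : R) (e : expr) (D : C -> Prop) : 0 < rho ->
  continuous_on D (fun z : C => eval rho e (Re z) (Im z)).
Proof.
intros Hrho; apply continuous_on_forall; intros [x y] _.
now apply (proj1 (continuity_2d_pt_filterlim _ _ _)), continuity_2d_pt_eval.
Qed.

Lemma u_smooth (rho : R) : 0 < rho -> smooth_up_to_boundary (u_ rho).
Proof.
intros Hrho.
assert (Hin : forall x y, eval rho Bubble x y = in_coords (u_ rho) x y)
  by (intros x y; symmetry; apply u_eval).
split; [|split].
- apply continuous_on_ext with (fun z => eval rho Bubble (Re z) (Im z)).
  + intros z _; symmetry; apply u_eval.
  + now apply continuous_on_eval.
- intros n z _.
  apply ex_diff_n_ext_loc with (2 := ex_diff_n_eval rho n Bubble _ _ Hrho).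
  now apply locally_2d_forall.
- intros m k.
  (* The extension to the closed disk is the same expression, continuous on the whole plane because
     its denominator never vanishes. *)
  exists (fun z => eval rho (Nat.iter m (dx rho) (Nat.iter k (dy rho) Bubble)) (Re z) (Im z)).
  split; [now apply continuous_on_eval|]; intros z _.
  rewrite <- partial_derive_eval by assumption.
  apply Derive_n_ext; intros t; now apply Derive_n_ext.
Qed.

(** * The functions $u_R$ as solutions *)

Lemma Cmod_cis (alpha : R) : Cmod (cis alpha) = 1.
Proof.
apply Rsqr_inj; [apply Cmod_ge_0|lra|].
rewrite !Rsqr_pow2, Cmod2_alt; simpl Re; simpl Im.
rewrite <- !Rsqr_pow2, Rplus_comm, sin2_cos2; unfold Rsqr; ring.
Qed.

Lemma u_radial (rho : R) : radial (u_ rho).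
Proof.
intros alpha z _; unfold u_; now rewrite Cmod_mult, Cmod_cis, Rmult_1_l.
Qed.

Lemma u_laplacian (rho : R) (z : C) : 0 < rho ->
  - laplacian (u_ rho) z = exp (2 * u_ rho z).
Proof.
intros Hrho.
assert (Hin : forall m k, partial_derive m k (in_coords (u_ rho)) (Re z) (Im z) =
    eval rho (Nat.iter m (dx rho) (Nat.iter k (dy rho) Bubble)) (Re z) (Im z)).
{ intros m k; rewrite <- partial_derive_eval by assumption.
  apply Derive_n_ext; intros t; apply Derive_n_ext; intros s; apply u_eval. }
pose proof (bubble_den_pos rho (Re z) (Im z)) as Hden.
unfold laplacian; rewrite !Hin, u_eval; simpl Nat.iter; cbn [dx dy eval].
(* Doubling is written as a sum so that the exponential becomes the square of $2R/(1+R^2|z|^2)$. *)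
replace (2 * _) with (ln (2 * rho / (1 + rho ^ 2 * (Re z ^ 2 + Im z ^ 2))) +
  ln (2 * rho / (1 + rho ^ 2 * (Re z ^ 2 + Im z ^ 2)))) by ring.
rewrite exp_plus, exp_ln by (apply Rdiv_lt_0_compat; lra).
field; lra.
Qed.

(** Since $\zeta+h\zeta=(1+h)\zeta$ has modulus $|1+h|$, the quotient is that of a function of one
    real variable, differentiable at $h=0$ from both sides. *)
Lemma u_normal_derive (rho : R) (zeta : C) : 0 < rho -> unit_circle zeta ->
  is_normal_derive (u_ rho) zeta (- 2 * rho ^ 2 / (1 + rho ^ 2)).
Proof.
intros Hrho Hzeta; unfold unit_circle in Hzeta.
assert (Hd : is_derive (fun h => eval rho Bubble (1 + h) 0) 0
    (- 2 * rho ^ 2 / (1 + rho ^ 2))).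
{ pose proof (bubble_den_pos rho 1 0) as Hden; simpl eval.
  auto_derive.
  - rewrite Rplus_0_r. split; [simpl in *; lra|]. split; [|exact I].
    apply Rdiv_lt_0_compat; simpl in *; lra.
  - field; simpl in *; lra. }
apply is_derive_Reals in Hd.
apply filterlim_locally; intros eps.
destruct (Hd eps (cond_pos eps)) as [delta Hdelta].
exists delta; intros h Hh Hneg.
assert (Heq : forall s : R, u_ rho (Cplus zeta (Cmult (RtoC s) (outer_normal zeta))) =
    eval rho Bubble (1 + s) 0).
{ intros s; unfold outer_normal.
  replace (Cplus zeta (Cmult (RtoC s) zeta)) with (Cmult (RtoC (1 + s)) zeta)
    by (rewrite RtoC_plus; ring).
  unfold u_; simpl eval; rewrite Cmod_mult, Hzeta, Rmult_1_r, Cmod_R, pow2_abs.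
  do 3 f_equal; ring. }
assert (Heq0 : u_ rho zeta = eval rho Bubble (1 + 0) 0).
{ rewrite <- Heq; f_equal; unfold outer_normal; ring. }
rewrite Heq, Heq0.
replace (1 + h) with (1 + (0 + h)) by ring.
apply Hdelta; [lra|].
change (Rabs (h - 0) < delta) in Hh; now rewrite Rminus_0_r in Hh.
Qed.

Lemma u_boundary (rho : R) (zeta : C) : 0 < rho -> unit_circle zeta ->
  exp (u_ rho zeta) = 2 * rho / (1 + rho ^ 2).
Proof.
intros Hrho Hzeta; unfold u_; rewrite Hzeta, pow1, Rmult_1_r.
apply exp_ln, Rdiv_lt_0_compat; [lra|].
pose proof (pow2_ge_0 rho); lra.
Qed.

Lemma u_radial_solution (lambda rho : R) : 0 < rho ->
  (lambda - 2) * rho ^ 2 - 2 * rho + lambda = 0 -> radial_solution lambda (u_ rho).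
Proof.
intros Hrho Hquad; split; [now apply u_smooth|].
split; [apply u_radial|].
split; [intros z _; now apply u_laplacian|].
intros zeta Hzeta; eexists; split; [now apply u_normal_derive|].
rewrite u_boundary by assumption.
pose proof (pow2_ge_0 rho).
(* This is the quadratic relation solved for $\lambda$. *)
replace lambda with ((2 * rho + 2 * rho ^ 2) / (1 + rho ^ 2)); field_simplify_eq; nra.
Qed.

(** * The radial equation on $(0,1)$ *)

Lemma constant_of_zero_derive (F : R -> R) : continuity_pt F 0 ->
  (forall r : R, 0 < r < 1 -> is_derive F r 0) ->
  forall r : R, 0 <= r < 1 -> F r = F 0.
Proof.
intros Hcont Hd r Hr.
destruct (MVT_gen F 0 r (fun _ => 0)) as [c [_ Hc]].
- intros x; rewrite Rmin_left, Rmax_right by lra; intros Hx; apply Hd; lra.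
- intros x; rewrite Rmin_left, Rmax_right by lra; intros Hx.
  (* At the centre only continuity is given; elsewhere it follows from differentiability. *)
  destruct (Req_dec x 0) as [->|Hx0]; [exact Hcont|].
  apply continuity_pt_filterlim, (ex_derive_continuous F x).
  exists 0; apply Hd; lra.
- lra.
Qed.

(* In the proof, [E] is the conserved quantity and [K] is (e^{-f})'/r. *)
Lemma radial_liouville_regular (f f1 f2 : R -> R) :
  (forall r : R, 0 <= r < 1 -> is_derive f r (f1 r)) ->
  (forall r : R, 0 <= r < 1 -> is_derive f1 r (f2 r)) ->
  (forall r : R, 0 < r < 1 -> - (f2 r + f1 r / r) = exp (2 * f r)) ->
  exists rho : R, 0 < rho /\
    forall r : R, 0 <= r < 1 -> f r = ln (2 * rho / (1 + rho ^ 2 * r ^ 2)).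
Proof.
intros Hf Hf1 Hode.
assert (Hf' : forall r, 0 <= r < 1 -> Derive (fun x : R => f x) r = f1 r)
  by (intros r Hr; now apply is_derive_unique, Hf).
assert (Hf1' : forall r, 0 <= r < 1 -> Derive (fun x : R => f1 x) r = f2 r)
  by (intros r Hr; now apply is_derive_unique, Hf1).
set (E := fun r => (1 + r * f1 r) ^ 2 + r ^ 2 * exp (2 * f r)).
(* For $r>0$ the last factor is $r(f''+f'/r+e^{2f})$, which the equation makes zero. *)
assert (HdE : forall r, 0 <= r < 1 -> is_derive E r
    (2 * (1 + r * f1 r) * (f1 r + r * f2 r + r * exp (2 * f r)))).
{ intros r Hr; pose proof (Hf r Hr) as H; pose proof (Hf1 r Hr) as H1.
  unfold E; auto_derive.
  - repeat split; eexists; eassumption.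
  - rewrite (Hf' r Hr), (Hf1' r Hr); ring. }
(* This is $E=1$ expanded and divided by $r^2$; the value 1 is $E(0)$. *)
assert (HE : forall r, 0 < r < 1 -> 2 * f1 r / r + f1 r ^ 2 + exp (2 * f r) = 0).
{ intros r Hr.
  assert (Hconst : E r = E 0).
  { apply constant_of_zero_derive; [| |lra].
    - apply continuity_pt_filterlim, (ex_derive_continuous E 0).
      eexists; apply HdE; lra.
    - intros s Hs.
      replace 0 with (2 * (1 + s * f1 s) * (f1 s + s * f2 s + s * exp (2 * f s))).
        apply HdE; lra.
      rewrite <- Hode by lra; field; lra. }
  unfold E in Hconst.
  replace (2 * f1 r / r + f1 r ^ 2 + exp (2 * f r)) with
    (((1 + r * f1 r) ^ 2 + r ^ 2 * exp (2 * f r) - 1) / r ^ 2) by (field; lra).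
  rewrite Hconst; field; lra. }
set (K := fun r => - f1 r * exp (- f r) / r).
assert (HdK : forall r, 0 < r < 1 -> is_derive K r 0).
{ intros r Hr.
  assert (Hr0 : 0 <= r < 1) by lra.
  pose proof (Hf r Hr0) as H; pose proof (Hf1 r Hr0) as H1.
  unfold K; auto_derive.
  - repeat split; try (eexists; eassumption); lra.
  - rewrite (Hf' r Hr0), (Hf1' r Hr0).
    pose proof (HE r Hr) as H2; rewrite <- Hode in H2 by lra.
    (* Eliminating $e^{2f}$ between the equation and the conservation law leaves $f''=f'/r+f'^2$,
       which is equivalent to $K'=0$. *)
    replace (f2 r) with (f1 r / r + f1 r ^ 2) by lra.
    field; lra. }
(* [K] divides by [r], so its constant value is read off at an interior point; 1/2 is an arbitrary
   choice. *)
set (k := K (1 / 2)).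
assert (HK : forall r, 0 < r < 1 -> K r = k).
{ intros r Hr; unfold k.
  destruct (Rtotal_order r (1 / 2)) as [Hlt|[->|Hlt]]; [|reflexivity|symmetry];
    apply (eq_is_derive K); try exact Hlt; intros t Ht; apply HdK; lra. }
(* Integration of $(e^{-f})'=kr$ from the centre: the difference [G] of the two sides, up to a
   constant, has derivative $r(K-k)=0$. *)
assert (Hpsi : forall r, 0 <= r < 1 -> exp (- f r) = exp (- f 0) + k * r ^ 2 / 2).
{ set (G := fun r => exp (- f r) - k * r ^ 2 / 2).
  assert (HdG : forall r, 0 <= r < 1 -> is_derive G r (- f1 r * exp (- f r) - k * r)).
  { intros r Hr; pose proof (Hf r Hr) as H; unfold G; auto_derive.
    - eexists; eassumption.
    - rewrite (Hf' r Hr); field. }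
  intros r Hr.
  assert (HG : G r = G 0).
  { apply constant_of_zero_derive; [| |exact Hr].
    - apply continuity_pt_filterlim, (ex_derive_continuous G 0).
      eexists; apply HdG; lra.
    - intros s Hs; replace 0 with (- f1 s * exp (- f s) - k * s).
        apply HdG; lra.
      rewrite <- (HK s Hs); unfold K; field; lra. }
  unfold G in HG; lra. }
(* The conservation law ties the two integration constants together. At $r=1/2$, dividing it by
   $e^{2f}$ and inserting the affine form of $e^{-f}$ cancels the $k^2$ terms and leaves
   $1-2ke^{-f(0)}=0$. *)
assert (Hk : 2 * k * exp (- f 0) = 1).
{ assert (Hhalf : 0 < 1 / 2 < 1) by lra.
  pose proof (HE _ Hhalf) as H; pose proof (Hpsi (1 / 2) ltac:(lra)) as H1.
  assert (Hf1k : f1 (1 / 2) = - k * (1 / 2) * exp (f (1 / 2))).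
  { unfold k, K; rewrite exp_Ropp; field; apply Rgt_not_eq, exp_pos. }
  rewrite Hf1k in H; replace (2 * f (1 / 2)) with (f (1 / 2) + f (1 / 2)) in H by ring.
  rewrite exp_plus in H.
  assert (Hinv : exp (f (1 / 2)) * exp (- f (1 / 2)) = 1)
    by (rewrite <- exp_plus, Rplus_opp_r; apply exp_0).
  rewrite H1 in Hinv.
  set (e := exp (f (1 / 2))) in *; set (A := exp (- f 0)) in *.
  assert (He : e * e * (1 - 2 * k * A) = 0).
  { replace (e * e * (1 - 2 * k * A)) with
      (2 * (- k * (1 / 2) * e) / (1 / 2) + (- k * (1 / 2) * e) ^ 2 + e * e
       + 2 * k * e * (1 - e * (A + k * (1 / 2) ^ 2 / 2))) by field.
    rewrite H, Hinv; ring. }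
  assert (0 < e) by apply exp_pos.
  destruct (Rmult_integral _ _ He); [nra|lra]. }
assert (HA : 0 < exp (- f 0)) by apply exp_pos.
assert (Hkpos : 0 < k) by nra.
(* With $e^{-f(0)}=1/(2k)$ the affine form inverts to $e^f=2k/(1+k^2r^2)$, so $R=k$. *)
exists k; split; [exact Hkpos|]; intros r Hr.
rewrite <- (ln_exp (f r)); f_equal.
replace (f r) with (- - f r) by ring.
rewrite exp_Ropp, Hpsi by exact Hr.
replace (exp (- f 0)) with (/ (2 * k)) by (rewrite <- (Rmult_1_r (/ _)), <- Hk; field; lra).
pose proof (pow2_ge_0 (k * r)); field; split; nra.
Qed.

(** * Reduction of the disk problem to the radial equation *)

Lemma is_derive_radius (r y : R) : 0 < r ->
  is_derive (fun t => sqrt (r ^ 2 + t ^ 2)) y (y / sqrt (r ^ 2 + y ^ 2)).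
Proof.
intros Hr; assert (Hpos : 0 < r ^ 2 + y ^ 2) by nra.
auto_derive; [simpl in *; lra|].
pose proof (sqrt_lt_R0 _ Hpos); simpl pow in *; field; lra.
Qed.

(** This supplies the term $f'/r$ of the radial Laplacian. With $s=\sqrt{r^2+y^2}$ the first
    derivative in $y$ is $yf'(s)/s$ near 0; since the factor $y$ vanishes at 0, differentiating once
    more leaves only the other factor, $f'(r)/r$. *)
Lemma Derive_n_2_radial (f f1 : R -> R) (r : R) : 0 < r ->
  locally r (fun s => is_derive f s (f1 s)) -> ex_derive f1 r ->
  Derive_n (fun y => f (sqrt (r ^ 2 + y ^ 2))) 2 0 = f1 r / r.
Proof.
intros Hr Hf Hf1.
set (s := fun y => sqrt (r ^ 2 + y ^ 2)).
assert (Hs0 : s 0 = r).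
{ unfold s; rewrite pow_i, Rplus_0_r by auto with arith; apply sqrt_pow2; lra. }
assert (Hs : forall y, is_derive s y (y / s y)) by (intros y; now apply is_derive_radius).
transitivity (Derive (fun y => f1 (s y) / s y * y) 0).
- apply Derive_ext_loc.
  assert (Hcont : filterlim s (locally 0) (locally r)).
  { rewrite <- Hs0; apply (ex_derive_continuous s 0); eexists; apply Hs. }
  assert (Hloc : locally 0 (fun y => is_derive f (s y) (f1 (s y)))) by exact (Hcont _ Hf).
  revert Hloc; apply filter_imp; intros y Hy.
  apply is_derive_unique.
  replace (f1 (s y) / s y * y) with (scal (y / s y) (f1 (s y)))
    by (unfold scal; simpl; unfold mult; simpl; unfold Rdiv; ring).
  now apply (is_derive_comp f s).
- apply is_derive_unique; auto_derive.
  + rewrite Hs0; repeat split; [exact Hf1|eexists; apply Hs| |lra].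
    eexists; apply Hs.
  + rewrite Hs0; field; lra.
Qed.

(** The angle is the arccosine of the normalized real part, up to sign; the sine of an arccosine is
    nonnegative, so the sign is that of the imaginary part. *)
Lemma polar_form (z : C) : exists alpha : R, z = Cmult (cis alpha) (RtoC (Cmod z)).
Proof.
destruct z as [a b]; set (m := Cmod (a, b)).
assert (Hm2 : m ^ 2 = a ^ 2 + b ^ 2) by apply (Cmod2_alt (a, b)).
assert (Hm0 : 0 <= m) by apply Cmod_ge_0.
destruct (Req_dec m 0) as [Hm|Hm].
{ exists 0; assert (a = 0) by nra; assert (b = 0) by nra.
  rewrite Hm; subst a b; unfold RtoC, Cmult; simpl; f_equal; ring. }
assert (Hunit : (a / m) ^ 2 + (b / m) ^ 2 = 1).
{ replace ((a / m) ^ 2 + (b / m) ^ 2) with ((a ^ 2 + b ^ 2) / m ^ 2) by (field; lra).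
  rewrite <- Hm2; field; lra. }
assert (Hrange : -1 <= a / m <= 1) by nra.
assert (Hsin : sin (acos (a / m)) = Rabs (b / m)).
{ rewrite sin_acos, <- sqrt_Rsqr_abs by exact Hrange; f_equal; rewrite !Rsqr_pow2; lra. }
destruct (Rle_dec 0 (b / m)) as [Hb|Hb].
- exists (acos (a / m)); unfold cis; rewrite Hsin, cos_acos, Rabs_pos_eq by lra.
  unfold RtoC, Cmult; simpl; f_equal; field; lra.
- exists (- acos (a / m)); unfold cis.
  rewrite sin_neg, cos_neg, Hsin, cos_acos, Rabs_left by lra.
  unfold RtoC, Cmult; simpl; f_equal; field; lra.
Qed.

Lemma radial_profile (v : C -> R) (z : C) : radial v -> closed_disk z ->
  v z = v (RtoC (Cmod z)).
Proof.
intros Hrad Hz; destruct (polar_form z) as [alpha Halpha].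
rewrite Halpha at 1; apply Hrad.
unfold closed_disk; now rewrite Cmod_R, Rabs_pos_eq by apply Cmod_ge_0.
Qed.

(** The equation is needed only on the real axis: there the $x$-derivatives of $v$ are those of the
    profile, and radial symmetry turns the second $y$-derivative into $f'/r$. As 0 is interior to
    the disk, the profile is differentiable there from both sides. *)
Lemma radial_solution_interior (lambda : R) (v : C -> R) : radial_solution lambda v ->
  exists rho : R, 0 < rho /\ forall r : R, 0 <= r < 1 -> v (RtoC r) = u_ rho (RtoC r).
Proof.
intros [[_ [Hdiff _]] [Hrad [Hpde _]]].
set (f := fun r : R => v (RtoC r)).
assert (Hdisk : forall r, 0 <= r < 1 -> open_disk (RtoC r)).
{ intros r Hr; unfold open_disk; rewrite Cmod_R, Rabs_pos_eq; lra. }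
assert (Hf : forall r, 0 <= r < 1 -> is_derive f r (Derive f r)).
{ intros r Hr; apply Derive_correct.
  exact (proj1 (proj2 (Hdiff 1%nat _ (Hdisk r Hr)))). }
assert (Hf1 : forall r, 0 <= r < 1 -> is_derive (Derive f) r (Derive_n f 2 r)).
{ intros r Hr; apply Derive_correct.
  (* The component kept is the differentiability in $x$ of the first $x$-derivative. *)
  destruct (Hdiff 2%nat _ (Hdisk r Hr)) as [_ [_ [_ [[_ [H _]] _]]]]; exact H. }
destruct (radial_liouville_regular f (Derive f) (Derive_n f 2)) as [rho [Hrho Hform]];
  [exact Hf|exact Hf1| |].
- intros r Hr.
  assert (Hr0 : 0 <= r < 1) by lra.
  etransitivity; [|exact (Hpde _ (Hdisk r Hr0))].
  f_equal; unfold laplacian; f_equal.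
  change (Derive f r / r = Derive_n (fun y => in_coords v r y) 2 0); symmetry.
  rewrite <- (Derive_n_2_radial f (Derive f)).
  + apply Derive_n_ext_loc.
    (* [radial] speaks of the closed disk only; $|y|<1-r$ keeps $(r,y)$ inside it. *)
    assert (Hgap : 0 < 1 - r) by lra.
    exists (mkposreal _ Hgap); intros y Hy.
    change (Rabs (y - 0) < 1 - r) in Hy; rewrite Rminus_0_r in Hy.
    apply (radial_profile v (r, y)); [exact Hrad|].
    unfold closed_disk, Cmod; simpl fst; simpl snd.
    rewrite <- sqrt_1; apply sqrt_le_1_alt.
    apply Rabs_def2 in Hy; nra.
  + lra.
  + assert (Hgap : 0 < Rmin r (1 - r)) by (apply Rmin_pos; lra).
    exists (mkposreal _ Hgap); intros s Hs.
    change (Rabs (s - r) < Rmin r (1 - r)) in Hs.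
    apply Hf; apply Rabs_def2 in Hs.
    pose proof (Rmin_l r (1 - r)); pose proof (Rmin_r r (1 - r)); lra.
  + eexists; now apply Hf1.
- exists rho; split; [exact Hrho|]; intros r Hr; unfold u_.
  rewrite Cmod_R, pow2_abs; now apply Hform.
Qed.

(** * Passage to the boundary *)

Lemma continuous_on_left_boundary (v : C -> R) : continuous_on closed_disk v ->
  filterlim (fun r : R => v (RtoC r)) (at_left 1) (locally (v (RtoC 1))).
Proof.
intros Hcont.
assert (H1 : closed_disk (RtoC 1)) by (unfold closed_disk; rewrite Cmod_1; lra).
eapply filterlim_comp; [|exact (Hcont _ H1)].
intros P [eps HP].
(* The bound 1 keeps [r] positive, hence $|r|=r<1$ and the point stays in the disk. *)
exists (mkposreal _ (Rmin_pos _ _ Rlt_0_1 (cond_pos eps))); intros r Hr Hlt.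
change (Rabs (r - 1) < Rmin 1 eps) in Hr.
pose proof (Rmin_l 1 eps); pose proof (Rmin_r 1 eps).
apply HP.
- split; [change (Rabs (r - 1) < eps); lra|apply ball_center].
- apply Rabs_def2 in Hr; unfold closed_disk; rewrite Cmod_R, Rabs_pos_eq; lra.
Qed.

(** Continuity extends the interior formula to the circle. Both functions then have the same
    difference quotients at the boundary point 1, so the boundary condition for $v$ becomes the
    quadratic in $R$. *)
Lemma radial_solution_form (lambda : R) (v : C -> R) : radial_solution lambda v ->
  exists rho : R, 0 < rho /\ (lambda - 2) * rho ^ 2 - 2 * rho + lambda = 0 /\
    eq_on_closed_disk v (u_ rho).
Proof.
intros Hv; destruct (radial_solution_interior _ _ Hv) as [rho [Hrho Hint]].
destruct Hv as [[Hcont _] [Hrad [_ Hbd]]].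
assert (Hone : v (RtoC 1) = u_ rho (RtoC 1)).
{ apply (filterlim_locally_unique (F := at_left 1) (fun r : R => v (RtoC r))).
  - now apply continuous_on_left_boundary.
  - apply filterlim_ext_loc with (fun r : R => u_ rho (RtoC r)).
    + exists (mkposreal _ Rlt_0_1); intros r Hr Hlt.
      change (Rabs (r - 1) < 1) in Hr; apply Rabs_def2 in Hr.
      symmetry; apply Hint; lra.
    + apply continuous_on_left_boundary, u_smooth; exact Hrho. }
assert (Heq : eq_on_closed_disk v (u_ rho)).
{ intros z Hz.
  rewrite (radial_profile v), (radial_profile (u_ rho)) by auto using u_radial.
  pose proof (Cmod_ge_0 z); destruct (Rle_lt_or_eq_dec _ _ Hz) as [Hlt|Heq].
  - apply Hint; lra.
  - now rewrite Heq. }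
exists rho; split; [exact Hrho|]; split; [|exact Heq].
assert (Hcircle : unit_circle (RtoC 1)) by apply Cmod_1.
destruct (Hbd _ Hcircle) as [d [Hd Hflux]].
assert (Hdval : d = - 2 * rho ^ 2 / (1 + rho ^ 2)).
{ apply (filterlim_locally_unique (F := at_left 0) _ _ _ Hd).
  eapply filterlim_ext_loc; [|exact (u_normal_derive _ _ Hrho Hcircle)].
  (* For $-1<h<0$ the point $1+h$ lies in $(0,1)$, where the interior formula applies. *)
  exists (mkposreal _ Rlt_0_1); intros h Hh Hneg.
  change (Rabs (h - 0) < 1) in Hh; apply Rabs_def2 in Hh.
  unfold outer_normal; rewrite Cmult_1_r, <- RtoC_plus, Hone, Hint by lra; reflexivity. }
rewrite Hdval, Hone, u_boundary in Hflux by assumption.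
pose proof (pow2_ge_0 rho).
assert (Hmul : (- 2 * rho ^ 2 / (1 + rho ^ 2) + lambda) * (1 + rho ^ 2) = 2 * rho)
  by (rewrite Hflux; field; lra).
replace ((lambda - 2) * rho ^ 2 - 2 * rho + lambda) with
  ((- 2 * rho ^ 2 / (1 + rho ^ 2) + lambda) * (1 + rho ^ 2) - 2 * rho) by (field; lra).
lra.
Qed.

(** * Positive roots of the quadratic and the five cases *)

Lemma unique_radial_solution_of_root (lambda rho : R) : 0 < rho ->
  (forall s : R, 0 < s -> (lambda - 2) * s ^ 2 - 2 * s + lambda = 0 <-> s = rho) ->
  unique_radial_solution lambda (u_ rho).
Proof.
intros Hrho Hroot; split.
- apply u_radial_solution; [exact Hrho|]; now apply Hroot.
- intros v Hv; destruct (radial_solution_form _ _ Hv) as [s [Hs [Hquad Heq]]].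
  now rewrite <- (proj1 (Hroot s Hs) Hquad).
Qed.

(** The value at the origin is $\log 2R$, which already determines $R$. *)
Lemma u_inj (rho1 rho2 : R) : 0 < rho1 -> 0 < rho2 ->
  eq_on_closed_disk (u_ rho1) (u_ rho2) -> rho1 = rho2.
Proof.
intros H1 H2 Heq.
assert (H0 : closed_disk 0) by (unfold closed_disk; rewrite Cmod_0; lra).
specialize (Heq _ H0); unfold u_ in Heq.
rewrite Cmod_0, pow_i, !Rmult_0_r, Rplus_0_r, !Rdiv_1_r in Heq by auto with arith.
apply ln_inv in Heq; lra.
Qed.

Theorem corollary1p6 (lambda : R) (lambda_pos : 0 < lambda) :
  (lambda < 2 ->
     let rho := lambda / (1 + sqrt (1 + 2 * lambda - lambda ^ 2)) in
     0 < rho /\ unique_radial_solution lambda (u_ rho)) /\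
  (lambda = 2 -> unique_radial_solution lambda (u_ 1)) /\
  (2 < lambda < 1 + sqrt 2 ->
     let rho_plus := (1 + sqrt (1 + 2 * lambda - lambda ^ 2)) / (lambda - 2) in
     let rho_minus := (1 - sqrt (1 + 2 * lambda - lambda ^ 2)) / (lambda - 2) in
     0 < rho_plus /\ 0 < rho_minus /\
     exactly_two_radial_solutions lambda (u_ rho_plus) (u_ rho_minus)) /\
  (lambda = 1 + sqrt 2 -> unique_radial_solution lambda (u_ (1 + sqrt 2))) /\
  (1 + sqrt 2 < lambda -> ~ exists u : C -> R, radial_solution lambda u).
Proof.
pose proof (sqrt_lt_R0 2 ltac:(lra)) as Hs0.
pose proof (sqrt_sqrt 2 ltac:(lra)) as Hs2.
assert (Hs1 : 1 < sqrt 2) by nra.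
split; [|split; [|split; [|split]]].
- intros Hlt rho.
  set (D := sqrt (1 + 2 * lambda - lambda ^ 2)) in rho.
  assert (HD0 : 0 <= D) by apply sqrt_pos.
  assert (HD : D * D = 1 + 2 * lambda - lambda ^ 2) by (apply sqrt_sqrt; nra).
  assert (Hrho : 0 < rho) by (apply Rdiv_lt_0_compat; lra).
  split; [exact Hrho|].
  apply unique_radial_solution_of_root; [exact Hrho|]; intros s Hs.
  (* The factorization rests on $D^2-1=\lambda(2-\lambda)$. It avoids dividing by $\lambda-2$, and
     its first factor vanishes exactly at [rho]. *)
  assert (Hfac : (lambda - 2) * s ^ 2 - 2 * s + lambda =
      (lambda - (1 + D) * s) * (1 + s * (D - 1) / lambda)).
  { replace (lambda - 2) with ((D * D - 1) / - lambda) by (rewrite HD; field; lra).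
    field; lra. }
  (* The second factor has no positive root, because $(D-1)/\lambda=(2-\lambda)/(1+D)>0$. *)
  assert (Hneq : 0 < 1 + s * (D - 1) / lambda).
  { replace (s * (D - 1) / lambda) with (s * (2 - lambda) / (1 + D)).
    - assert (0 < s * (2 - lambda) / (1 + D)) by (apply Rdiv_lt_0_compat; nra); lra.
    - replace (2 - lambda) with ((D * D - 1) / lambda) by (rewrite HD; field; lra).
      field; lra. }
  rewrite Hfac; split.
  + intros H; destruct (Rmult_integral _ _ H); [|lra].
    unfold rho; apply Rmult_eq_reg_r with (1 + D); [field_simplify|]; lra.
  + intros ->; unfold rho; field; lra.
(* At $\lambda=2$ the quadratic term drops out and $2-2s=0$ remains. *)
- intros ->; apply unique_radial_solution_of_root; [lra|]; intros s Hs; split; nra.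
- intros [Hgt Hlt] rho_plus rho_minus.
  set (D := sqrt (1 + 2 * lambda - lambda ^ 2)) in rho_plus, rho_minus.
  assert (Hdisc : 0 < 1 + 2 * lambda - lambda ^ 2) by nra.
  assert (HD0 : 0 < D) by now apply sqrt_lt_R0.
  assert (HD : D * D = 1 + 2 * lambda - lambda ^ 2) by (apply sqrt_sqrt; lra).
  (* Here $D^2=1-\lambda(\lambda-2)<1$, which makes [rho_minus] positive. *)
  assert (HD1 : D < 1) by nra.
  assert (Hplus : 0 < rho_plus) by (apply Rdiv_lt_0_compat; lra).
  assert (Hminus : 0 < rho_minus) by (apply Rdiv_lt_0_compat; lra).
  assert (Hfac : forall s, (lambda - 2) * s ^ 2 - 2 * s + lambda =
      (lambda - 2) * ((s - rho_plus) * (s - rho_minus))).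
  { intros s; unfold rho_plus, rho_minus; field_simplify_eq; [|lra].
    replace (D ^ 2) with (1 + 2 * lambda - lambda ^ 2) by (rewrite <- HD; ring); ring. }
  split; [exact Hplus|]; split; [exact Hminus|].
  split; [apply u_radial_solution; [exact Hplus|rewrite Hfac; ring]|].
  split; [apply u_radial_solution; [exact Hminus|rewrite Hfac; ring]|].
  split.
  + intros Heq; apply u_inj in Heq; [|exact Hplus|exact Hminus].
    unfold rho_plus, rho_minus in Heq; apply Rmult_eq_reg_r in Heq; [lra|].
    apply Rinv_neq_0_compat; lra.
  + intros v Hv; destruct (radial_solution_form _ _ Hv) as [s [Hs [Hquad Heq]]].
    rewrite Hfac in Hquad.
    destruct (Rmult_integral _ _ Hquad) as [H|H]; [lra|].
    destruct (Rmult_integral _ _ H); [left|right].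
    * now replace rho_plus with s by lra.
    * now replace rho_minus with s by lra.
- intros ->; apply unique_radial_solution_of_root; [lra|]; intros s Hs.
  (* The discriminant vanishes, and the double root is $1/(\lambda-2)=1/(\sqrt2-1)=1+\sqrt2$. *)
  assert (Hfac : (1 + sqrt 2 - 2) * s ^ 2 - 2 * s + (1 + sqrt 2) =
      (sqrt 2 - 1) * (s - (1 + sqrt 2)) ^ 2) by nra.
  rewrite Hfac; split; [|intros ->; ring].
  intros H; destruct (Rmult_integral _ _ H); nra.
- intros Hgt [v Hv]; destruct (radial_solution_form _ _ Hv) as [s [Hs [Hquad _]]].
  assert (Hdisc : 1 + 2 * lambda - lambda ^ 2 < 0) by nra.
  (* Completing the square at a root would make a square equal to a negative number. *)
  assert (((lambda - 2) * s - 1) ^ 2 = 1 + 2 * lambda - lambda ^ 2).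
  { replace (((lambda - 2) * s - 1) ^ 2) with
      ((lambda - 2) * ((lambda - 2) * s ^ 2 - 2 * s + lambda)
       + (1 + 2 * lambda - lambda ^ 2)) by ring.
    rewrite Hquad; ring. }
  pose proof (pow2_ge_0 ((lambda - 2) * s - 1)); lra.
Qed.
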